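(* Let $d\ge1$ and let $(\mathbf X_t)_{t\ge0}$ be a stationary integer-grid random walk Metropolis--Hastings (IRWMH) chain on $\mathbb Z^d$ with target probability mass function $\pi$ and proposal step probability mass function $\phi$. If $\mathbf X_0\in L^2$ and $\mathbf X_0$ is not degenerate (i.e. $\operatorname{trVar}\mathbf X_0>0$), then $$\operatorname{trCorr}(\mathbf X_0,\mathbf X_1)\ge0.$$
   Context: IRWMH chain: $\pi$ and $\phi$ are probability mass functions on $\mathbb Z^d$. Set $q(\mathbf x,\mathbf y)=\phi(\mathbf y-\mathbf x)$ and $$\alpha(\mathbf x,\mathbf y)=\begin{cases}\min\{1,\ \pi(\mathbf y)q(\mathbf y,\mathbf x)/(\pi(\mathbf x)q(\mathbf x,\mathbf y))\},&\pi(\mathbf x)q(\mathbf x,\mathbf y)>0,\\ 1,&\pi(\mathbf x)q(\mathbf x,\mathbf y)=0.\end{cases}$$ From state $\mathbf x\in\mathbb Z^d$, the Markov chain proposes $\mathbf y$ with probability $q(\mathbf x,\mathbf y)$, moves to $\mathbf y$ with probability $\alpha(\mathbf x,\mathbf y)$, and otherwise stays at $\mathbf x$; so its off-diagonal transition probabilities are $q(\mathbf x,\mathbf y)\alpha(\mathbf x,\mathbf y)$. The chain is stationary: $\mathbf X_0$ (hence every $\mathbf X_t$) has probability mass function $\pi$. $\mathbf X_0\in L^2$ means $\mathbb E\|\mathbf X_0\|^2<\infty$ (Euclidean norm). For random vectors $\mathbf Y,\tilde{\mathbf Y}\in L^2$ in $\mathbb R^d$: $\operatorname{trCov}(\mathbf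 Y,\tilde{\mathbf Y})=\sum_{i=1}^d\operatorname{Cov}(Y_i,\tilde Y_i)$, $\operatorname{trVar}\mathbf Y=\operatorname{trCov}(\mathbf Y,\mathbf Y)$, and, when neither vector is degenerate, $\operatorname{trCorr}(\mathbf Y,\tilde{\mathbf Y})=\operatorname{trCov}(\mathbf Y,\tilde{\mathbf Y})/\big((\operatorname{trVar}\mathbf Y)^{1/2}(\operatorname{trVar}\tilde{\mathbf Y})^{1/2}\big)$. *)

(* Defs.v *)
From HB Require Import structures.
From mathcomp Require Import all_boot all_order all_algebra.
From mathcomp Require Import all_classical all_reals all_analysis.

Set Implicit Arguments.
Unset Strict Implicit.
Unset Printing Implicit Defensive.

Import Order.TTheory GRing.Theory Num.Theory.

Local Open Scope classical_set_scope.
Local Open Scope ring_scope.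

Definition is_pmf (R : realType) (S : choiceType) (p : S -> R) : Prop :=
  (forall x, 0 <= p x) /\ (\esum_(x in [set: S]) (p x)%:E = 1)%E.

Section IRWMH.
Variables (R : realType) (d : nat) (pi phi : 'rV[int]_d -> R).

Definition proposal (x y : 'rV[int]_d) : R := phi (y - x).

Definition acceptance (x y : 'rV[int]_d) : R :=
  if 0 < pi x * proposal x y
  then Num.min 1 (pi y * proposal y x / (pi x * proposal x y))
  else 1.

(* The second summand is the total mass of rejected proposals from [x]; an
   accepted proposal equal to [x] is counted by the first summand. *)
Definition transition (x y : 'rV[int]_d) : \bar R :=
  ((proposal x y * acceptance x y)%:E +
   (if x == y then
      \esum_(z in [set: 'rV[int]_d]) (proposal x z * (1 - acceptance x z))%:E
    else 0))%E.

(* [X_measurable] is measurability for the discrete sigma-algebra on Z^d.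
   [X_markov] is the Markov property together with the transition law, in the
   form P(X_0 = x_0, .., X_{n+1} = x_{n+1})
        = P(X_0 = x_0, .., X_n = x_n) K(x_n, x_{n+1}),
   which avoids conditioning on null events. *)
Record stationary_IRWMH (disp : measure_display) (T : measurableType disp)
    (P : probability T R) (X : nat -> T -> 'rV[int]_d) : Prop := {
  X_measurable : forall t (A : set 'rV[int]_d), measurable (X t @^-1` A) ;
  X_initial : forall x, P (X 0%N @^-1` [set x]) = (pi x)%:E ;
  X_markov : forall (n : nat) (x : nat -> 'rV[int]_d),
    (P [set w | forall k, (k <= n.+1)%N -> X k w = x k] =
     P [set w | forall k, (k <= n)%N -> X k w = x k] *
       transition (x n) (x n.+1))%E }.

End IRWMH.

Definition real_vec (R : realType) (d : nat) (T : Type)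
    (X : T -> 'rV[int]_d) : T -> 'rV[R]_d :=
  fun w => map_mx intr (X w).

(* Mathcomp-Analysis equips ['rV[R]_d] with the sup norm. *)
Definition enorm (R : realType) (d : nat) (y : 'rV[R]_d) : R :=
  Num.sqrt (\sum_(i < d) y 0 i ^+ 2).

Section RandomVectors.
Variables (R : realType) (d : nat) (disp : measure_display).
Variables (T : measurableType disp) (P : probability T R).

Definition in_L2 (Y : T -> 'rV[R]_d) : Prop :=
  (forall i : 'I_d, measurable_fun [set: T] (fun w => Y w 0 i)) /\
  ('E_P[(fun w => enorm (Y w) ^+ 2)%R] < +oo)%E.

Definition trCov (Y Y' : T -> 'rV[R]_d) : \bar R :=
  (\sum_(i < d) covariance P (fun w => Y w ord0 i) (fun w => Y' w ord0 i))%E.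

Definition trVar (Y : T -> 'rV[R]_d) : \bar R := trCov Y Y.

(* Meaningful for nondegenerate vectors in L^2, for which [trCov] and [trVar]
   are finite and the denominator is nonzero. *)
Definition trCorr (Y Y' : T -> 'rV[R]_d) : R :=
  fine (trCov Y Y') /
    (Num.sqrt (fine (trVar Y)) * Num.sqrt (fine (trVar Y'))).

End RandomVectors.

(* Main.v *)
Require Import Defs.
From mathcomp Require Import all_boot all_order all_algebra.
From mathcomp Require Import all_classical all_reals all_analysis.
From mathcomp Require Import measurable_realfun ring lra.

(** The heart of the matter is the mean square jump inequality
      E |X_1 - X_0|^2 <= 2 E |X_0 - m|^2   for every m in R^d.
    The chain is reversible, so X_1 has the law of X_0; taking m = E X_0, the
    pointwise identity |u - v|^2 = |u|^2 + |v|^2 - 2 <u, v> with u = X_0 - m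
    and v = X_1 - m then turns the inequality into
    trCov(X_0, X_1) = E <u, v> >= 0.

    To prove it, write the left side as a sum over jumps h of
      |h|^2 sum_x min(pi(x) phi(h), pi(x + h) phi(- h)),
    and let t(x) = <x - m, h> / |h|^2, so that t(x + h) = t(x) + 1.  The key
    point is [min_unit_step_le]: each minimum is at most (phi(h) + phi(- h))
    times
      pi(x) t(x)^2 [t(x) < 0] + pi(x + h) t(x + h)^2 [t(x + h) > 0].
    A site pays for its right neighbour only when it is on the negative side
    of m, and for its left neighbour only when it is on the positive side, so
    summing over x charges every site once, and the total is
    (phi(h) + phi(- h)) sum_x pi(x) t(x)^2.  Since |h|^2 t(x)^2 <= |x - m|^2
    (the squared length of a projection), the jump h contributes at most
    (phi(h) + phi(- h)) E |X_0 - m|^2 ([jump_along_le]), and the weights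
    phi(h) + phi(- h) sum to 2 ([expected_jump_le]).  All terms are
    nonnegative, so every rearrangement of these infinite sums is
    legitimate. *)

Import Order.TTheory GRing.Theory Num.Theory.
Local Open Scope classical_set_scope.
Local Open Scope ring_scope.

(** * Two points a unit step apart *)

Section PairBound.
Context {R : realFieldType}.

(** For positive [p] and [q] and with w the minimum, a >= w / p and b >= w / q,
    while s^2 / p + (1 - s)^2 / q >= 1 / (p + q) by the Cauchy-Schwarz
    inequality. *)
Lemma min_weights_le (a b p q s : R) :
  0 <= a -> 0 <= b -> 0 <= p -> 0 <= q ->
  Num.min (a * p) (b * q) <= (p + q) * (a * s ^+ 2 + b * (1 - s) ^+ 2).
Proof.
move=> a0 b0 p0 q0; set w := Num.min _ _.
have wl : w <= a * p by rewrite ge_min lexx.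
have wr : w <= b * q by rewrite ge_min lexx orbT.
have w0 : 0 <= w by rewrite le_min !mulr_ge0.
clearbody w.
have rhs0 : 0 <= (p + q) * (a * s ^+ 2 + b * (1 - s) ^+ 2).
  by rewrite mulr_ge0 ?addr_ge0// mulr_ge0// sqr_ge0.
move: p0; rewrite le_eqVlt => /orP[/eqP p0|p0].
  by apply: le_trans rhs0; rewrite -p0 mulr0 in wl.
move: q0; rewrite le_eqVlt => /orP[/eqP q0|q0].
  by apply: le_trans rhs0; rewrite -q0 mulr0 in wr.
have pq0 : 0 < p * q by rewrite mulr_gt0.
(* Multiplying by p q clears the denominators; the square in the identity below
   is the defect in the Cauchy-Schwarz inequality. *)
rewrite -subr_ge0 -(pmulr_rge0 _ pq0).
rewrite (_ : p * q * _ = (p + q) * (q * s ^+ 2 * (a * p - w)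
    + p * (1 - s) ^+ 2 * (b * q - w)) + w * (q * s - p * (1 - s)) ^+ 2);
  last by ring.
rewrite addr_ge0//; last by rewrite mulr_ge0 ?sqr_ge0.
apply: mulr_ge0; first by rewrite addr_ge0// ltW.
by apply: addr_ge0; apply: mulr_ge0;
  rewrite ?subr_ge0// mulr_ge0 ?sqr_ge0// ltW.
Qed.

Definition sqr_neg (t : R) : R := if t < 0 then t ^+ 2 else 0.
Definition sqr_pos (t : R) : R := if 0 < t then t ^+ 2 else 0.

Lemma sqr_neg_ge0 t : 0 <= sqr_neg t.
Proof. by rewrite /sqr_neg; case: ifP => //; rewrite sqr_ge0. Qed.

Lemma sqr_pos_ge0 t : 0 <= sqr_pos t.
Proof. by rewrite /sqr_pos; case: ifP => //; rewrite sqr_ge0. Qed.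

Lemma sqr_negDpos t : sqr_neg t + sqr_pos t = t ^+ 2.
Proof.
rewrite /sqr_neg /sqr_pos.
by case: (ltgtP t 0) => [_|_|->]; rewrite ?addr0 ?add0r ?expr0n.
Qed.

(** Two points at the positions [t] and [t + 1] relative to a centre.  If both
    lie on the same side of it, the farther one is at distance at least 1 and
    its own term already dominates the minimum; if they straddle the centre,
    [min_weights_le] applies with s = - t.  Using the one-sided squares instead
    of [t ^+ 2] and [(t + 1) ^+ 2] leaves the term of the nearer point free for
    the neighbouring pair, which saves a factor 2 once such bounds are added
    along a line. *)
Lemma min_unit_step_le (a b p q t : R) :
  0 <= a -> 0 <= b -> 0 <= p -> 0 <= q ->
  Num.min (a * p) (b * q) <= (p + q) * (a * sqr_neg t + b * sqr_pos (t + 1)).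
Proof.
move=> a0 b0 p0 q0.
have [t0|t0] := leP 0 t.
  rewrite /sqr_neg /sqr_pos ltNge t0 /= ltr_wpDl// mulr0 add0r.
  rewrite (@le_trans _ _ (b * q)) ?ge_min ?lexx ?orbT//.
  have : 0 <= b * p by rewrite mulr_ge0.
  have : 0 <= b * q by rewrite mulr_ge0.
  nra.
rewrite /sqr_neg /sqr_pos t0; case: ifP => [t1|/negbT].
  have := @min_weights_le a b p q (- t) a0 b0 p0 q0.
  by rewrite sqrrN opprK [1 + t]addrC.
rewrite -leNgt => t1; rewrite mulr0 addr0.
rewrite (@le_trans _ _ (a * p)) ?ge_min ?lexx//.
have t1' : 1 <= t ^+ 2 by nra.
apply: (@le_trans _ _ (a * p * t ^+ 2)); first by rewrite ler_peMr// mulr_ge0.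
have : 0 <= a * q * t ^+ 2 by rewrite mulr_ge0 ?sqr_ge0// mulr_ge0.
lra.
Qed.

Lemma norm_mul_le (a b : R) : `|a * b| <= a ^+ 2 + b ^+ 2.
Proof.
rewrite ler_norml.
have := sqr_ge0 a; have := sqr_ge0 b.
have := sqr_ge0 (a + b); have := sqr_ge0 (a - b).
by move=> *; apply/andP; split; lra.
Qed.

End PairBound.

(** * The Euclidean inner product *)

Section Dot.
Context {R : realType} {d : nat}.
Implicit Types u v : 'rV[R]_d.

Definition dot u v : R := \sum_(i < d) u 0 i * v 0 i.

Lemma dotDl u u' v : dot (u + u') v = dot u v + dot u' v.
Proof.
by rewrite /dot -big_split; apply: eq_bigr => i _; rewrite !mxE mulrDl.
Qed.

Lemma dotZl a u v : dot (a *: u) v = a * dot u v.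
Proof.
by rewrite /dot mulr_sumr; apply: eq_bigr => i _; rewrite !mxE mulrA.
Qed.

Lemma dotC u v : dot u v = dot v u.
Proof. by apply: eq_bigr => i _; rewrite mulrC. Qed.

Lemma dot_ge0 u : 0 <= dot u u.
Proof. by apply: sumr_ge0 => i _; rewrite -expr2 sqr_ge0. Qed.

Lemma enorm_sqr u : enorm u ^+ 2 = dot u u.
Proof.
rewrite /enorm sqr_sqrtr; first by apply: eq_bigr => i _; rewrite expr2.
by apply: sumr_ge0 => i _; rewrite sqr_ge0.
Qed.

(** The left side is the squared length of the projection of [u] on the line
    of [h], and the difference of the two sides is the squared length of the
    remainder.  When [h] is zero, division by zero makes the left side zero. *)
Lemma projection_sqr_le u h :
  dot h h * (dot u h / dot h h) ^+ 2 <= dot u u.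
Proof.
have [->|h0] := eqVneq (dot h h) 0; first by rewrite mul0r dot_ge0.
set t := _ / _.
have ut : dot u h = t * dot h h by rewrite /t divfK.
clearbody t; have := dot_ge0 (u + (- t) *: h).
rewrite !(dotDl, dotZl, dotC _ (_ + _), dotC _ (_ *: _)).
rewrite (dotC h u) ut; lra.
Qed.

Lemma dot_norm_le u v : `|dot u v| <= dot u u + dot v v.
Proof.
rewrite /dot -big_split /=; apply: le_trans (ler_norm_sum _ _ _) _.
by apply: ler_sum => i _; rewrite -!expr2 norm_mul_le.
Qed.

Lemma dot_polarization u v m : dot (u - v) (u - v) =
  dot (u - m) (u - m) + dot (v - m) (v - m) - 2 * dot (u - m) (v - m).
Proof.
rewrite /dot -big_split /= mulr_sumr -sumrB; apply: eq_bigr => i _.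
by rewrite !mxE; ring.
Qed.

(** This dominates the summands of [dot u v] one at a time, so that the
    coordinate covariances can be added under the integral. *)
Lemma coord_mul_le u v i : `|u 0 i * v 0 i| <= dot u u + dot v v.
Proof.
have coord_le (z : 'rV[R]_d) : z 0 i ^+ 2 <= dot z z.
  rewrite /dot (bigD1 i)//= -expr2 lerDl.
  by apply: sumr_ge0 => j _; rewrite -expr2 sqr_ge0.
apply: le_trans (lerD (coord_le u) (coord_le v)).
exact: norm_mul_le.
Qed.

End Dot.

(** * Sums of nonnegative families *)

Section Esum.
Context {R : realType}.
Local Open Scope ereal_scope.

Lemma esumZl_le {S : choiceType} (c : R) (f : S -> \bar R) :
  (0 <= c)%R -> (forall s, 0 <= f s) ->
  \esum_(s in setT) (c%:E * f s) <= c%:E * \esum_(s in setT) f s.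
Proof.
move=> c0 f0; apply: ge_ereal_sup => _ [A [finA AT] <-].
rewrite -ge0_mule_fsumr//; apply: lee_wpmul2l; first by rewrite lee_fin.
by apply: esum_ge; exists A.
Qed.

Lemma esum_bij {S S' : choiceType} (e : S -> S') (f : S' -> \bar R) :
  bijective e -> \esum_(s in setT) f s = \esum_(s in setT) f (e s).
Proof. by move=> eb; apply: reindex_esum; rewrite setTT_bijective. Qed.

Lemma esum_pairs {S S' : choiceType} (f : S -> S' -> \bar R) :
  (forall s t, 0 <= f s t) ->
  \esum_(s in setT) \esum_(t in setT) f s t =
  \esum_(z in [set: S * S']) f z.1 z.2.
Proof.
move=> f0; rewrite esum_esum//; congr esum.
by apply/seteqP; split.
Qed.

End Esum.

(** * Expectations of countably valued random variables *)

Section DiscreteRV.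
Context {R : realType} {disp : measure_display} {T : measurableType disp}.
Context (P : probability T R) {S : countType} (Z : T -> S).
Hypothesis mZ : forall A : set S, measurable (Z @^-1` A).

Lemma discrete_measurable_fun {disp'} {U : measurableType disp'} (f : S -> U) :
  measurable_fun setT (f \o Z).
Proof. by move=> _ B mB; rewrite setTI comp_preimage. Qed.

Local Open Scope ereal_scope.

Lemma ge0_integral_discrete (g : S -> \bar R) : (forall s, 0 <= g s) ->
  \int[P]_w g (Z w) = \esum_(s in setT) (g s * P (Z @^-1` [set s])).
Proof.
move=> g0.
pose F n := Z @^-1` [set s | pickle s = n].
have FT : \bigcup_n F n = setT.
  by apply/seteqP; split => // w _; exists (pickle (Z w)).
pose a n := oapp (fun s => g s * P (Z @^-1` [set s])) 0 (pickle_inv n).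
have a0 n : 0 <= a n.
  by rewrite /a; case: (pickle_inv n) => //= s; rewrite mule_ge0.
(* The level sets of [Z], numbered by [pickle], partition the space; numbers
   that encode no element of [S] give empty sets and zero terms. *)
rewrite -[X in integral P X _]FT ge0_integral_bigcup //=; first last.
- by move=> i j _ _ [w [/= <- <-]].
- by rewrite FT; exact: discrete_measurable_fun.
- by move=> n; exact: mZ.
transitivity (\sum_(n <oo) a n).
  apply: eq_eseriesr => n _; rewrite /a.
  case E : (pickle_inv n) => [s|] /=.
    have ns : pickle s = n by have := @pickle_invK S n; rewrite E.
    have -> : F n = Z @^-1` [set s].
      rewrite /F -ns; apply/seteqP; split => w /=; last by move=> ->.
      exact: (pcan_inj pickleK).
    rewrite (_ : integral _ _ _ = \int[P]_(w in Z @^-1` [set s]) (cst (g s)) w).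
      by rewrite integral_cst.
    by apply: eq_integral => w; rewrite inE /= => ->.
  have -> : F n = set0.
    rewrite /F; apply/seteqP; split => w //= nE.
    by move: E; rewrite -nE pickleK_inv.
  by rewrite integral_set0.
rewrite nneseries_esumT//.
rewrite (esumID (range (@pickle S)))// setTI [X in _ + X]esum1 ?adde0; last first.
  move=> n [_ /= nr]; rewrite /a; case E : (pickle_inv n) => [s|] //=.
  by exfalso; apply: nr; exists s => //; have := @pickle_invK S n; rewrite E.
rewrite esum_image; last by move=> s t _ _; exact: (pcan_inj pickleK).
by apply: eq_esum => s _; rewrite /a pickleK_inv.
Qed.

End DiscreteRV.

(** * The first two states of the chain *)

(** The stationary mass per unit time that crosses from [x] to a site [y] other
    than [x]; see [joint_offdiag]. *)
Definition flow {R : realType} {d : nat} (pi phi : 'rV[int]_d -> R)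
    (x y : 'rV[int]_d) : R :=
  Num.min (pi x * phi (y - x)) (pi y * phi (x - y)).

Definition emb {R : realType} {d : nat} (x : 'rV[int]_d) : 'rV[R]_d :=
  map_mx intr x.

Lemma embD {R : realType} {d : nat} (x y : 'rV[int]_d) :
  emb (x + y) = emb x + emb y :> 'rV[R]_d.
Proof. by apply/rowP => i; rewrite !mxE intrD. Qed.

Definition sqdist {R : realType} {d : nat} (m : 'rV[R]_d)
    (x : 'rV[int]_d) : R :=
  dot (emb x - m) (emb x - m).

Section TwoSteps.
Context {R : realType} {d : nat} { pi phi : 'rV[int]_d -> R}.
Hypotheses (pi_ge0 : forall x, 0 <= pi x) (phi_ge0 : forall x, 0 <= phi x).
Context {disp : measure_display} {T : measurableType disp}.
Context {P : probability T R} {X : nat -> T -> 'rV[int]_d}.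
Hypothesis hX : stationary_IRWMH pi phi P X.
Let S : countType := 'rV[int]_d.

Lemma flowC (x y : S) : flow pi phi x y = flow pi phi y x.
Proof. by rewrite /flow minC. Qed.

Lemma flow_ge0 (x y : S) : 0 <= flow pi phi x y.
Proof. by rewrite le_min !mulr_ge0. Qed.

(** The acceptance probability is chosen to make the accepted flow symmetric;
    when no proposal is possible, both sides vanish. *)
Lemma accepted_flow (x y : S) :
  pi x * (proposal phi x y * acceptance pi phi x y) = flow pi phi x y.
Proof.
rewrite mulrA /acceptance /flow /proposal.
case: ifPn => [q0|]; last first.
  rewrite lt_neqAle mulr_ge0// andbT negbK => /eqP <-.
  by rewrite mul0r min_l// mulr_ge0.
by rewrite minr_pMr ?ltW// mulr1 mulrCA divff ?mulr1// gt_eqF.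
Qed.

Definition joint (z : S * S) : \bar R :=
  P ((fun w => (X 0%N w, X 1%N w)) @^-1` [set z]).

Lemma pair_measurable (A : set (S * S)) :
  measurable ((fun w => (X 0%N w, X 1%N w)) @^-1` A).
Proof.
rewrite (_ : _ @^-1` A = \bigcup_(x : S)
    (X 0%N @^-1` [set x] `&` X 1%N @^-1` [set y | A (x, y)])).
  apply: countable_bigcupT_measurable => // x.
  by apply: measurableI; exact: X_measurable hX _ _.
apply/seteqP; split => w /=; first by exists (X 0%N w).
by move=> [x _ [/= <-]].
Qed.

Lemma jointE (x y : S) :
  joint (x, y) = ((pi x)%:E * transition pi phi x y)%E.
Proof.
rewrite -(X_initial hX x).
have := X_markov hX 0 (fun k => if k is 0%N then x else y) => /= M.
rewrite (_ : X 0%N @^-1` [set x] =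
    [set w | forall k, (k <= 0)%N -> X k w = if k is 0%N then x else y]).
  rewrite -M; congr (P _); apply/seteqP; split => w /=.
    by move=> [<- <-] [|[|k]].
  by move=> h; rewrite (h 0%N)// (h 1%N).
apply/seteqP; split => w /=; first by move=> <- [|].
exact: (fun h => h 0%N isT).
Qed.

Lemma joint_offdiag (x y : S) : x != y -> joint (x, y) = (flow pi phi x y)%:E.
Proof.
move=> xy; rewrite jointE /transition (negbTE xy) adde0 -EFinM.
by rewrite accepted_flow.
Qed.

(** Reversibility.  The rejected mass sits on the diagonal, where the exchange
    of the two states changes nothing. *)
Lemma jointC (x y : S) : joint (x, y) = joint (y, x).
Proof.
have [->//|xy] := eqVneq x y.
by rewrite !joint_offdiag// 1?eq_sym// flowC.
Qed.

Local Open Scope ereal_scope.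

Lemma ge0_exchange (g : S -> S -> \bar R) : (forall x y, 0 <= g x y) ->
  \int[P]_w g (X 0%N w) (X 1%N w) = \int[P]_w g (X 1%N w) (X 0%N w).
Proof.
move=> g0.
have /= -> := ge0_integral_discrete P _ pair_measurable
  (fun z : S * S => g z.1 z.2) (fun z => g0 _ _).
have /= -> := ge0_integral_discrete P _ pair_measurable
  (fun z : S * S => g z.2 z.1) (fun z => g0 _ _).
rewrite [RHS](esum_bij (fun z : S * S => (z.2, z.1))); last first.
  by exists (fun z : S * S => (z.2, z.1)) => -[].
by apply: eq_esum => -[x y] _ /=; congr (_ * _); exact: jointC.
Qed.

(** Exchangeability of the first two states gives them the same law, without a
    summation of the transition probabilities. *)
Lemma integral_stationary (f : S -> \bar R) :
  \int[P]_w f (X 1%N w) = \int[P]_w f (X 0%N w).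
Proof.
rewrite integralE [RHS]integralE; congr (_ - _).
  by have := ge0_exchange (fun _ y => f^\+ y) (fun _ => funepos_ge0 f);
    rewrite funepos.unlock.
by have := ge0_exchange (fun _ y => f^\- y) (fun _ => funeneg_ge0 f);
  rewrite funeneg.unlock.
Qed.

(** The contribution of the jump [h] to the mean square jump.  In the proof,
    [t x] is the coordinate of [x - m] along [h] in units of the length of [h],
    [A x] is what the site [x] pays for the pair (x, x + h), and [B x] what it
    pays for the pair (x - h, x). *)
Lemma jump_along_le (m : 'rV[R]_d) (h : S) :
  \esum_(x in [set: S]) (dot (emb h) (emb h) * flow pi phi x (x + h))%:E <=
  (phi h + phi (- h))%:E * \esum_(x in [set: S]) (pi x * sqdist m x)%:E.
Proof.
set N := dot (emb h) (emb h).
pose t (x : S) := (dot (emb x - m) (emb h) / N)%R.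
pose A (x : S) := (pi x * (N * sqr_neg (t x)))%R.
pose B (x : S) := (pi x * (N * sqr_pos (t x)))%R.
have N0 : (0 <= N)%R := dot_ge0 _.
have A0 x : 0 <= (A x)%:E by rewrite lee_fin !mulr_ge0 ?sqr_neg_ge0.
have B0 x : 0 <= (B x)%:E by rewrite lee_fin !mulr_ge0 ?sqr_pos_ge0.
apply: (@le_trans _ _ (\esum_(x in [set: S])
    ((phi h + phi (- h))%:E * ((A x)%:E + (B (x + h))%:E)))).
  apply: le_esum => x _; rewrite -EFinD -EFinM lee_fin.
  (* A null jump contributes nothing, and for it [t] is meaningless. *)
  have [N00|Nn0] := eqVneq N 0%R.
    rewrite N00 mul0r mulr_ge0// ?addr_ge0//.
      by rewrite -lee_fin; exact: A0.
    by rewrite -lee_fin; exact: B0.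
  have tS : t (x + h)%R = (t x + 1)%R.
    by rewrite /t embD addrAC (dotDl (emb x - m)) -/N mulrDl divff.
  rewrite /A /B tS /flow [(x + h)%R]addrC addrK opprD addrCA subrr addr0.
  have := min_unit_step_le (pi x) (pi (h + x)%R) (phi h) (phi (- h)) (t x)
    (pi_ge0 _) (pi_ge0 _) (phi_ge0 _) (phi_ge0 _).
  move=> /(ler_wpM2l N0) /le_trans; apply.
  rewrite le_eqVlt; apply/orP; left; apply/eqP; ring.
apply: le_trans (esumZl_le _ _ _ _) _ => [|x|]; rewrite ?addr_ge0//.
  by rewrite adde_ge0.
apply: lee_wpmul2l; first by rewrite lee_fin addr_ge0.
rewrite esumD//.
rewrite -(esum_bij (fun x : S => x + h)%R (EFin \o B)); last first.
  by exists (fun x : S => x - h)%R => x; rewrite ?addrK ?subrK.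
(* After the shift by [h], the two payments of a site are added: together they
   make up a full square. *)
rewrite -esumD//; last by move=> x _; exact: B0.
apply: le_esum => x _.
rewrite lee_fin -mulrDr -mulrDr sqr_negDpos ler_wpM2l//.
exact: projection_sqr_le.
Qed.

(** The sum over all pairs of states is reorganised by jumps, so that
    [jump_along_le] applies to each; the weights [phi h + phi (- h)] add up
    to 2. *)
Lemma expected_jump_le (m : 'rV[R]_d) (V : R) :
  \esum_(h in [set: S]) (phi h)%:E = 1 ->
  \esum_(x in [set: S]) (pi x * sqdist m x)%:E = V%:E ->
  \int[P]_w (dot (emb (X 0%N w) - emb (X 1%N w))
                 (emb (X 0%N w) - emb (X 1%N w)))%:E <= (2 * V)%:E.
Proof.
move=> phi1 VE.
have V0 : (0 <= V)%R.
  by rewrite -lee_fin -VE esum_ge0// => x _; rewrite lee_fin mulr_ge0// dot_ge0.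
have /= -> := ge0_integral_discrete P _ pair_measurable
  (fun z : S * S => (dot (emb z.1 - emb z.2) (emb z.1 - emb z.2))%:E)
  (fun z => dot_ge0 _).
(* Reindexing by (h, x), where x is the initial state and h the jump. *)
rewrite (esum_bij (fun u : S * S => (u.2, u.2 + u.1)%R)); last first.
  by exists (fun z : S * S => (z.2 - z.1, z.1)%R) => -[x y] /=;
    rewrite ?subrK ?[(y + x)%R]addrC ?addrK// addrC subrK.
have jumpE (u : S * S) :
    (dot (emb u.2 - emb (u.2 + u.1)) (emb u.2 - emb (u.2 + u.1)))%:E *
      joint (u.2, u.2 + u.1)%R =
    (dot (emb u.1) (emb u.1) * flow pi phi u.2 (u.2 + u.1))%:E.
  case: u => h x /=; rewrite embD opprD addrA subrr add0r.
  have -> : dot (- emb h) (- emb h) = dot (emb h) (emb h) :> R.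
    by rewrite -scaleN1r dotZl dotC dotZl mulN1r mulN1r opprK.
  have [->|h0] := eqVneq h 0%R.
    rewrite (_ : emb 0%R = 0 *: 0)%R ?dotZl ?mul0r ?mul0e//.
    by apply/rowP => i; rewrite !mxE mul0r.
  by rewrite joint_offdiag ?EFinM// eq_sym -subr_eq0 addrC addKr.
rewrite (eq_esum (fun u _ => jumpE u)).
rewrite -(esum_pairs (fun h x : S =>
  (dot (emb h) (emb h) * flow pi phi x (x + h))%:E)); last first.
  by move=> h x; rewrite lee_fin mulr_ge0 ?dot_ge0 ?flow_ge0.
apply: (@le_trans _ _ (\esum_(h in [set: S])
    (V%:E * ((phi h)%:E + (phi (- h))%:E)))).
  apply: le_esum => h _; rewrite muleC -EFinD -VE; exact: jump_along_le.
apply: le_trans (esumZl_le _ _ _ _) _ => // [h|].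
  by rewrite -EFinD lee_fin addr_ge0.
rewrite mulrC EFinM; apply: lee_wpmul2l; first by rewrite lee_fin.
rewrite esumD//; try by move=> *; rewrite lee_fin.
rewrite -(esum_bij (fun x : S => - x)%R (EFin \o phi)); last first.
  by exists (fun x : S => - x)%R => x; rewrite opprK.
by rewrite phi1 -EFinD.
Qed.

End TwoSteps.

(** * The trace covariance *)

Section Covariance.
Context {R : realType} {d : nat} { pi phi : 'rV[int]_d -> R}.
Hypotheses (hpi : is_pmf pi) (hphi : is_pmf phi).
Context {disp : measure_display} {T : measurableType disp}.
Context {P : probability T R} {X : nat -> T -> 'rV[int]_d}.
Hypothesis hX : stationary_IRWMH pi phi P X.
Hypothesis hL2 : in_L2 P (real_vec R (X 0%N)).
Let S : countType := 'rV[int]_d.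
Let pi_ge0 := hpi.1.
Let phi_ge0 := hphi.1.
Local Open Scope ereal_scope.

Lemma pair_measurable_EFin (f : S -> S -> R) :
  measurable_fun setT (fun w => (f (X 0%N w) (X 1%N w))%:E).
Proof.
exact: (discrete_measurable_fun _ (pair_measurable hX)
  (fun z : S * S => (f z.1 z.2)%:E)).
Qed.

Lemma sqdist_fin (m : 'rV[R]_d) : \int[P]_w (sqdist m (X 0%N w))%:E < +oo.
Proof.
apply: (@le_lt_trans _ _ (\int[P]_w
    (2%:E * (dot (emb (X 0%N w) : 'rV[R]_d) (emb (X 0%N w)))%:E
      + (2 * dot m m)%:E))).
  apply: ge0_le_integral => //.
  - by move=> w _; rewrite lee_fin dot_ge0.
  - exact: (pair_measurable_EFin (fun x _ => sqdist m x)).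
  - exact: (pair_measurable_EFin
      (fun x _ => 2 * dot (emb x) (emb x) + 2 * dot m m)%R).
  move=> w _; rewrite -EFinM -EFinD lee_fin /sqdist /dot.
  rewrite !mulr_sumr -big_split /=.
  apply: ler_sum => i _; rewrite !mxE.
  set u := (_%:~R); set v := m ord0 i; have := sqr_ge0 (u + v)%R; nra.
rewrite ge0_integralD//; first last.
- by move=> w _; rewrite lee_fin mulr_ge0// dot_ge0.
- exact: (pair_measurable_EFin (fun x _ => 2 * dot (emb x) (emb x))%R).
- by move=> w _; rewrite mule_ge0 ?lee_fin// dot_ge0.
rewrite integral_cst// ge0_integralZl_EFin//; first last.
- exact: (pair_measurable_EFin (fun x _ => dot (emb x) (emb x))%R).
- by move=> w _; rewrite lee_fin dot_ge0.
rewrite /= probability_setT mule1 lte_add_pinfty ?ltry//.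
rewrite lte_mul_pinfty// ?lee_fin//.
have := hL2.2; rewrite unlock.
by under eq_integral do rewrite enorm_sqr.
Qed.

Lemma sqdist_integrable0 (m : 'rV[R]_d) :
  P.-integrable setT (fun w => (sqdist m (X 0%N w))%:E).
Proof.
apply/integrableP; split.
  exact: (pair_measurable_EFin (fun x _ => sqdist m x)).
under eq_integral do rewrite gee0_abs ?lee_fin ?dot_ge0//.
exact: sqdist_fin.
Qed.

Lemma sqdist_integrable1 (m : 'rV[R]_d) :
  P.-integrable setT (fun w => (sqdist m (X 1%N w))%:E).
Proof.
apply/integrableP; split.
  exact: (pair_measurable_EFin (fun _ y => sqdist m y)).
under eq_integral do rewrite gee0_abs ?lee_fin ?dot_ge0//.
rewrite (integral_stationary pi_ge0 phi_ge0 hX (fun x => (sqdist m x)%:E)).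
exact: sqdist_fin.
Qed.

Lemma dominated_integrable (m : 'rV[R]_d) (f : S -> S -> R) :
  (forall x y, `|f x y| <= sqdist m x + sqdist m y)%R ->
  P.-integrable setT (fun w => (f (X 0%N w) (X 1%N w))%:E).
Proof.
move=> fle.
have i01 := integrableD measurableT (sqdist_integrable0 m)
  (sqdist_integrable1 m).
apply: (le_integrable _ _ _ i01) => //; first exact: pair_measurable_EFin.
by move=> w _ /=; rewrite lee_fin [leRHS]ger0_norm ?addr_ge0 ?dot_ge0.
Qed.

(** The polarization identity expresses the inner product through the two
    squared distances to [m], which have the same finite mean V, and the
    squared jump, whose mean is at most 2 V. *)
Lemma integral_dot_ge0 (m : 'rV[R]_d) :
  0 <= \int[P]_w (dot (emb (X 0%N w) - m) (emb (X 1%N w) - m))%:E.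
Proof.
set I := integral _ _ _.
pose V := \int[P]_w (sqdist m (X 0%N w))%:E.
have V0 : 0 <= V by apply: integral_ge0 => w _; rewrite lee_fin dot_ge0.
have Vfin : V \is a fin_num by rewrite ge0_fin_numE// sqdist_fin.
have V1 : \int[P]_w (sqdist m (X 1%N w))%:E = V.
  exact: (integral_stationary pi_ge0 phi_ge0 hX (fun x => (sqdist m x)%:E)).
have Vsum : \esum_(x in [set: S]) (pi x * sqdist m x)%:E = (fine V)%:E.
  rewrite fineK// /V.
  have /= -> := ge0_integral_discrete P _ (X_measurable hX 0)
    (fun x : S => (sqdist m x)%:E) (fun x => dot_ge0 _).
  by apply: eq_esum => x _; rewrite (X_initial hX) EFinM muleC.
have := expected_jump_le pi_ge0 phi_ge0 hX m _ hphi.2 Vsum.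
have [i0 i1] := (sqdist_integrable0 m, sqdist_integrable1 m).
have i01 := integrableD measurableT i0 i1.
have idot : P.-integrable setT
    (fun w => (dot (emb (X 0%N w) - m) (emb (X 1%N w) - m))%:E).
  apply: (dominated_integrable m (fun x y => dot (emb x - m) (emb y - m))).
  by move=> x y; exact: dot_norm_le.
under eq_integral do rewrite (dot_polarization _ _ m) EFinB EFinD EFinM.
rewrite integralB//; last exact: integrableZl.
rewrite integralD// integralZl//.
have := integrable_fin_num measurableT idot.
rewrite -/I -/V V1 -{1 2}(fineK Vfin) => /fineK <-.
by rewrite -?EFinD -?EFinM -?EFinB /= !lee_fin; lra.
Qed.

(** By stationarity both states are centred at the same vector [m], the form in
    which [integral_dot_ge0] applies. *)
Lemma trCov_integral_dot
    (m := \row_i fine 'E_P[fun w => real_vec R (X 0%N) w ord0 i]) :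
  trCov P (real_vec R (X 0%N)) (real_vec R (X 1%N)) =
  \int[P]_w (dot (emb (X 0%N w) - m) (emb (X 1%N w) - m))%:E.
Proof.
rewrite /trCov.
transitivity (\sum_(i < d) \int[P]_w
    ((emb (X 0%N w) - m) ord0 i * (emb (X 1%N w) - m) ord0 i)%:E).
  apply: eq_bigr => i _; rewrite covariance.unlock.
  have same_mean : 'E_P[fun w => real_vec R (X 1%N) w ord0 i] =
      'E_P[fun w => real_vec R (X 0%N) w ord0 i].
    rewrite expectation.unlock.
    exact: (integral_stationary pi_ge0 phi_ge0 hX
      (fun x => (emb x ord0 i)%:E)).
  rewrite same_mean; set mu := fine _; rewrite expectation.unlock.
  apply: eq_integral => w _; congr EFin.
  rewrite -[LHS]/((real_vec R (X 0%N) w ord0 i - mu) *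
                  (real_vec R (X 1%N) w ord0 i - mu))%R.
  by rewrite !mxE.
rewrite -integral_sum//; last first.
  move=> i.
  apply: (dominated_integrable m
    (fun x y => (emb x - m) ord0 i * (emb y - m) ord0 i)%R).
  by move=> x y; exact: coord_mul_le.
by apply: eq_integral => w _; rewrite /dot sumEFin.
Qed.

End Covariance.

Theorem corollary5p2 (R : realType) (d : nat) (hd : (1 <= d)%N)
  (pi phi : 'rV[int]_d -> R) (hpi : is_pmf pi) (hphi : is_pmf phi)
  (disp : measure_display) (T : measurableType disp) (P : probability T R)
  (X : nat -> T -> 'rV[int]_d) (hX : stationary_IRWMH pi phi P X)
  (hL2 : in_L2 P (real_vec R (X 0%N)))
  (hnondeg : (0 < trVar P (real_vec R (X 0%N)))%E) :
  0 <= trCorr P (real_vec R (X 0%N)) (real_vec R (X 1%N)).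
Proof.
rewrite /trCorr divr_ge0 ?mulr_ge0 ?sqrtr_ge0// fine_ge0//.
rewrite (trCov_integral_dot hpi hphi hX hL2).
exact: (integral_dot_ge0 hpi hphi hX hL2).
Qed.
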